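(* For all positive integers $n$ and all integers $0\leq j\leq n-1$, $$\det(I_n-A_{C_n^j}^t)\;=\;\prod_{\ell=0}^{n-1}\left(1-\omega_\ell-\omega_\ell^{\,j}\right),$$ where $\omega_\ell=e^{2\pi i\ell/n}\in\mathbb{C}$.
   Context: $C_n^j$ is the directed graph with $n$ vertices $v_1,\dots,v_n$ and $2n$ edges $e_1,\dots,e_n,f_1,\dots,f_n$, where $e_i$ goes from $v_i$ to $v_{i+1}$ and $f_i$ goes from $v_i$ to $v_{i+j}$ (subscripts mod $n$). For a directed graph $E$ with vertices $v_1,\dots,v_n$, the incidence matrix $A_E=(a_{i,k})$ is the $n\times n$ matrix in which $a_{i,k}$ is the number of edges from $v_i$ to $v_k$; $A_E^t$ is its transpose and $I_n$ the $n\times n$ identity matrix. *)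

(* Defs.v *)
From HB Require Import structures.
From mathcomp Require Import all_boot all_order all_algebra.
From mathcomp Require Import complex.
From mathcomp Require Import reals sequences trigo.

Set Implicit Arguments.
Unset Strict Implicit.
Unset Printing Implicit Defensive.

Import Order.TTheory GRing.Theory Num.Theory.

Local Open Scope ring_scope.

(* Parallel edges and loops are allowed. *)
Record digraph (n : nat) := Digraph {
  edge : finType;
  source : edge -> 'I_n;
  target : edge -> 'I_n }.

Definition incidence_mx (n : nat) (E : digraph n) : 'M[int]_n :=
  \matrix_(i, k) #|[set a : edge E | source a == i & target a == k]|%:Z.

Lemma ltn_mod_ord (n : nat) (i : 'I_n) (m : nat) : (m %% n < n)%N.
Proof. by rewrite ltn_pmod // (leq_ltn_trans (leq0n i) (ltn_ord i)). Qed.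

Definition shift_ord (n : nat) (i : 'I_n) (k : nat) : 'I_n :=
  Ordinal (ltn_mod_ord i (i + k)).

(* The vertex v_(i+1) is represented by i : 'I_n; the edge e_(i+1) is inl i
   and the edge f_(i+1) is inr i. *)
Definition Cnj (n j : nat) : digraph n :=
  @Digraph n ('I_n + 'I_n)%type
    (fun a => match a with inl i => i | inr i => i end)
    (fun a => match a with inl i => shift_ord i 1 | inr i => shift_ord i j end).

(* e^(x + i y) = e^x (cos y + i sin y). *)
Definition cexp (R : realType) (z : R[i]) : R[i] :=
  let: (x +i* y)%C := z in (expR x * cos y +i* (expR x * sin y))%C.

Definition omega (R : realType) (n l : nat) : R[i] :=
  cexp (2 * (pi : R)%:C%C * 'i%C * l%:R / n%:R).

(* Main.v *)
Require Import Defs.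
From HB Require Import structures.
From mathcomp Require Import all_boot all_order all_algebra.
From mathcomp Require Import complex.
From mathcomp Require Import reals sequences exp trigo.

(** The rows and columns of the incidence matrix [A] are indexed by the
    integers mod [n], and an edge of the graph moves by [1] or by [j] whatever
    its source.  Hence [A] is a polynomial in the cyclic shift, and every
    [n]-th root of unity [z] gives an eigenvector [(z ^+ k)_k] of [A]:
    following [e_i] multiplies the entry by [z], following [f_i] multiplies it
    by [z ^+ j], so the eigenvalue is [z + z ^+ j]
    ([one_sub_incidence_mulmx_Vandermonde]).

    The [n] roots of unity [omega R n l] are pairwise distinct
    ([omega_inj]), so these eigenvectors are the columns of an invertible
    Vandermonde matrix [V].  Taking determinants in
    [(1 - A) V = V diag(1 - z_l - z_l ^+ j)] and cancelling [\det V] gives the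
    product formula ([det_one_sub_incidence_Cnj]); replacing [A] by its
    transpose does not change the determinant. *)

Set Implicit Arguments.
Unset Strict Implicit.
Unset Printing Implicit Defensive.

Import Order.TTheory GRing.Theory Num.Theory.

Local Open Scope ring_scope.

(** [A_E x] sums [x] over the heads of the edges leaving each vertex; grouping
    these edges by their head recovers the entries of [A_E], multiplicities
    included. *)
Lemma incidence_mx_sum (S : pzRingType) (n : nat) (E : digraph n)
    (x : 'I_n -> S) (i : 'I_n) :
  \sum_k (incidence_mx E i k)%:~R * x k =
    \sum_(a : edge E | source a == i) x (target a).
Proof.
rewrite (partition_big (@target n E) predT) //=.
apply: eq_bigr => k _.
rewrite (eq_bigr (fun=> x k)) => [|a /andP[_ /eqP -> //]].
rewrite sumr_const mxE mulr_natl; congr (_ *+ _).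
by apply: eq_card => a; rewrite inE.
Qed.

Lemma incidence_Cnj_sum (S : pzRingType) (n j : nat) (x : 'I_n -> S)
    (i : 'I_n) :
  \sum_k (incidence_mx (Cnj n j) i k)%:~R * x k =
    x (shift_ord i 1) + x (shift_ord i j).
Proof. by rewrite incidence_mx_sum big_sumType /= !big_pred1_eq. Qed.

(** The columns [(z ^+ k)_k] of the Vandermonde matrix are eigenvectors: since
    [z ^+ n = 1], the reduction mod [n] in [shift_ord] is invisible to the
    powers of [z]. *)
Lemma one_sub_incidence_mulmx_Vandermonde (S : comPzRingType) (n j : nat)
    (z : 'rV[S]_n) (z_unity : forall l, z 0 l ^+ n = 1) :
  map_mx intr (1%:M - incidence_mx (Cnj n j)) *m Vandermonde n z =
    Vandermonde n z *m diag_mx (\row_l (1 - z 0 l - z 0 l ^+ j)).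
Proof.
apply/matrixP => i l; rewrite mul_mx_diag !mxE.
under eq_bigr => k _.
  rewrite mxE [(1%:M - _) _ _]mxE [(- incidence_mx _) _ _]mxE.
  rewrite rmorphB /= mulrBl [1%:M _ _]mxE [Vandermonde _ _ _ _]mxE; over.
rewrite sumrB incidence_Cnj_sum (bigD1 i) //= eqxx mul1r big1 ?addr0; last first.
  by move=> k /negPf ne_ki; rewrite eq_sym ne_ki mul0r.
by rewrite !expr_mod // !exprD expr1 opprD addrA !mulrBr mulr1.
Qed.

Lemma det_Vandermonde_neq0 (S : idomainType) (n : nat) (z : 'rV[S]_n)
    (z_inj : injective (z 0)) : \det (Vandermonde n z) != 0.
Proof.
rewrite det_Vandermonde; apply/prodf_neq0 => i _; apply/prodf_neq0 => k lt_ik.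
by rewrite subr_eq0; apply: contraTneq lt_ik => /z_inj ->; rewrite ltnn.
Qed.

(** The [n] distinct roots of unity diagonalise [1 - A]. Cancelling [\det V]
    instead of inverting [V] is what lets the scalars be an integral domain. *)
Lemma det_one_sub_incidence_Cnj (S : idomainType) (n j : nat) (z : 'rV[S]_n)
    (z_inj : injective (z 0)) (z_unity : forall l, z 0 l ^+ n = 1) :
  (\det (1%:M - (incidence_mx (Cnj n j))^T))%:~R =
    \prod_(l < n) (1 - z 0 l - z 0 l ^+ j).
Proof.
apply: (mulIf (det_Vandermonde_neq0 z_inj)).
rewrite -[1%:M](trmx1 _ n) -linearB det_tr -det_map_mx -det_mulmx.
rewrite one_sub_incidence_mulmx_Vandermonde // det_mulmx det_diag mulrC.
by congr (_ * _); apply: eq_bigr => l _; rewrite mxE.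
Qed.

Definition angle (R : realType) (n l : nat) : R := 2 * pi * l%:R / n%:R.

Lemma omegaE (R : realType) (n l : nat) :
  omega R n l = (cos (angle R n l) +i* sin (angle R n l))%C.
Proof.
have -> : omega R n l = cexp ('i%C * (angle R n l)%:C%C).
  rewrite /omega /angle 3!rmorphM fmorphV !rmorph_nat /=.
  by rewrite !mulrA [_ * 'i%C]mulrC !mulrA.
by rewrite /cexp /= !(mul0r, mul1r) subr0 add0r expR0 !mul1r.
Qed.

Lemma de_Moivre (R : realType) (t : R) (m : nat) :
  (cos t +i* sin t)%C ^+ m = (cos (t *+ m) +i* sin (t *+ m))%C.
Proof.
elim: m => [|m IHm]; first by rewrite expr0 mulr0n cos0 sin0.
by rewrite exprS IHm mulrS cosD sinD; congr (_ +i* _)%C; rewrite /= addrC.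
Qed.

Lemma omegaX_n (R : realType) (n l : nat) (n_gt0 : (0 < n)%N) :
  omega R n l ^+ n = 1.
Proof.
rewrite omegaE de_Moivre.
have -> : angle R n l *+ n = pi *+ 2 *+ l.
  by rewrite -mulr_natr /angle divfK ?mulr_natr ?mulr_natl // pnatr_eq0 -lt0n.
by rewrite -de_Moivre cos2pi sin2pi expr1n.
Qed.

(** By the double-angle formula [cos (y *+ 2) = 1] forces [sin y = 0], which is
    excluded on [(0, pi)]. *)
Lemma cos_neq1 (R : realType) (x : R) : 0 < x < pi *+ 2 -> cos x != 1.
Proof.
move=> /andP[x_gt0 x_lt]; have -> : x = (x / 2) *+ 2 by rewrite -mulr_natr divfK ?pnatr_eq0.
have : 0 < sin (x / 2).
  by rewrite sin_gt0_pi // divr_gt0 //= ltr_pdivrMr // mulr_natr.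
rewrite cos_mulr2n cos2sin2; apply: contraTneq => /eqP.
rewrite mulrnBl addrAC mulr2n addrK -subr_eq0 addrAC subrr add0r.
by rewrite oppr_eq0 mulrn_eq0 /= sqrf_eq0 => /eqP ->; rewrite ltxx.
Qed.

(** Equal roots of unity have angles whose difference has cosine [1]; for
    [l, l' < n] that difference is less than a full turn. *)
Lemma omega_inj (R : realType) (n : nat) :
  injective (fun l : 'I_n => omega R n l).
Proof.
move=> l l'; wlog lt_ll' : l l' / (l < l')%N => [inj eq_om|].
  by have [/inj->|/inj->|/val_inj] := ltngtP l l'.
have n_gt0 : 0 < n%:R :> R by rewrite ltr0n (leq_ltn_trans _ (ltn_ord l)).
have lt_lR : (l%:R : R) < l'%:R by rewrite ltr_nat.
rewrite !omegaE => -[eq_cos eq_sin].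
have /cos_neq1/eqP[] : 0 < angle R n l' - angle R n l < pi *+ 2.
  have tau_gt0 : 0 < (pi : R) *+ 2 by rewrite pmulrn_lgt0 // pi_gt0.
  rewrite /angle mulr_natl -mulrBl -mulrBr divr_gt0 ?mulr_gt0 ?subr_gt0 //=.
  rewrite ltr_pdivrMr // ltr_pM2l // (le_lt_trans (y := l'%:R)) ?ltr_nat //.
  by rewrite gerBl.
by rewrite cosB eq_cos eq_sin -!expr2 cos2Dsin2.
Qed.

Theorem proposition2p1 (R : realType) (n j : nat) (n_gt0 : (0 < n)%N)
    (j_lt_n : (j < n)%N) :
  (\det (1%:M - (incidence_mx (Cnj n j))^T))%:~R =
    \prod_(l < n) (1 - omega R n l - omega R n l ^+ j).
Proof.
rewrite (@det_one_sub_incidence_Cnj _ n j (\row_l omega R n l)).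
- by apply: eq_bigr => l _; rewrite mxE.
- by move=> l l'; rewrite !mxE => /omega_inj.
- by move=> l; rewrite mxE omegaX_n.
Qed.
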